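(* For every $m\ge2$, $$\Delta_m-\Omega_m=\log G_m\ \le\ \log\left(\frac{m}{2^{v_2(m)}}\right)\ \le\ \log m,$$ while, with $m_k=\mathrm{lcm}(1,2,\dots,k)$, $$\Delta_{m_k}-\Omega_{m_k}\ \ge\ \log m_k-\log\log_2(2m_k)\qquad\text{for every }k\ge1.$$ If a sequence $(m_j)$ of integers $\ge2$ satisfies $\Delta_{m_j}-\log m_j\to\infty$, then $\Omega_{m_j}\to\infty$. (Thus the part $\Delta_m-\Omega_m$ of the Mersenne defect is at most $\log m$, and this scale is attained by the exponents $m_k$ within the correction $\log\log_2(2m_k)$.)
   Context: $\mathrm{rad}(n)$ is the product of the distinct primes dividing $n$, and $v_p$ is the $p$-adic valuation. For $m\ge1$ put $\Delta_m=\log\bigl((2^m-1)/\mathrm{rad}(2^m-1)\bigr)$. For an odd prime $p$, let $d_p$ be the multiplicative order of $2$ modulo $p$ and $A_p=v_p(2^{d_p}-1)$. $\mathcal{W}$ is the set of Wieferich primes, i.e. odd primes $p$ with $2^{p-1}\equiv1\pmod{p^2}$, and $\mathcal{W}(m)=\{p\in\mathcal{W}:p\mid2^m-1\}$. Put $\Omega_m=\sum_{p\in\mathcal{W}(m)}(A_p-1)\log p$ (empty sum $=0$) and $G_m=\prod_{p\mid2^m-1}p^{v_p(m)}$ (product over primes). $\log$ is the natural logarithm, $\log_2$ the logarithm to base $2$, and $\log\log_2(x)$ means $\log(\log_2 x)$. *)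

(* Defs.v *)
(* MathComp / MathComp-Analysis. *)
From mathcomp Require Import all_boot all_order all_algebra all_fingroup.
From mathcomp Require Import all_classical all_reals all_analysis.

Set Implicit Arguments.
Unset Strict Implicit.
Unset Printing Implicit Defensive.

Import Order.TTheory GRing.Theory Num.Theory.
Import numFieldNormedType.Exports.

Local Open Scope ring_scope.

Definition rad (n : nat) : nat := (\prod_(p <- primes n) p)%N.

Definition wieferich (p : nat) : bool :=
  [&& prime p, odd p & 2 ^ (p - 1) == 1 %[mod p ^ 2]]%N.

(* The order of the class of 2 in the group of units of Z/pZ.  It is meaningful
   for odd p > 1 only: otherwise 2 is not a unit of 'Z_p and insubd returns its
   default value. *)
Definition ord2 (p : nat) : nat :=
  #[insubd (1%g : {unit 'Z_p}) (2%:R : 'Z_p)]%g.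

Definition expA (p : nat) : nat := logn p (2 ^ ord2 p - 1).

Definition prodG (m : nat) : nat :=
  (\prod_(p <- primes (2 ^ m - 1)) p ^ logn p m)%N.

Definition lcm_upto (k : nat) : nat := \big[lcmn/1%N]_(1 <= i < k.+1) i.

Definition log2 (R : realType) (x : R) : R := ln x / ln 2.

Definition Delta (R : realType) (m : nat) : R :=
  ln ((2 ^ m - 1)%N%:R / (rad (2 ^ m - 1))%:R).

Definition Omega (R : realType) (m : nat) : R :=
  \sum_(p <- primes (2 ^ m - 1) | wieferich p) ((expA p)%:R - 1) * ln p%:R.

(* Main.v *)
Require Import Defs.
From mathcomp Require Import all_boot all_order all_algebra all_fingroup.
From mathcomp Require Import all_classical all_reals all_analysis.
From mathcomp Require Import cyclic ring lra zify.

(** Let N = 2^m - 1.  Every prime p dividing N is odd, and the order d of 2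
    modulo p divides m, say m = d t.  Lifting the exponent ([logn_expn_sub1])
    to x = 2^d gives v_p(N) = A_p + v_p(t).  As d divides p - 1, it is prime to
    p, so v_p(t) = v_p(m) and v_p(N) = A_p + v_p(m) ([logn_mersenne]).
    Summing (v_p(N) - 1) log p over the p dividing N splits Delta_m into the
    terms v_p(m) log p, whose sum is log G_m, and the terms (A_p - 1) log p,
    whose sum is Omega_m: applied to the exponent p - 1, the same formula shows
    that A_p - 1 is nonzero exactly at the Wieferich primes.  This is
    [Delta_sub_Omega].

    Since G_m is the part of m supported on the primes dividing N, and those
    are odd, G_m divides the odd part of m; this gives the upper bounds.  They
    also give Omega_m >= Delta_m - log m, which settles the assertion on
    sequences.

    For m = lcm(1, ..., k), every odd prime p dividing m satisfies p <= k, so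
    p - 1 divides m and p divides N by Fermat: here G_m is the whole odd part
    of m ([prodG_lcm_upto]).  What is lost is log 2^(v_2(m)), and
    2^(v_2(m)) <= k, being a divisor of one of 1, ..., k.  The bound
    k <= log_2(2 m) amounts to 2^(k-1) <= lcm(1, ..., k), proved by Nair's
    argument ([expn2_le_double_lcm_upto]): k C(k-1, j) divides lcm(1, ..., k)
    for every j, and the average over j of the numbers k C(k-1, j) is
    2^(k-1). *)

Set Implicit Arguments.
Unset Strict Implicit.
Unset Printing Implicit Defensive.

Import Order.TTheory GRing.Theory Num.Theory.
Import numFieldNormedType.Exports.

Local Open Scope classical_set_scope.
Local Open Scope ring_scope.

(** * Lifting the exponent at an odd prime *)

Lemma expn1pM_mod_sqr p y i :
  exists c, ((1 + p * y) ^ i = 1 + i * (p * y) + c * p ^ 2)%N.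
Proof.
elim: i => [|i [c IH]]; first by exists 0%N.
exists (i * y ^ 2 + c + c * p * y)%N; rewrite expnS IH; ring.
Qed.

(** Second-order precision is needed at n = p only: there the linear term
    C(p, 2) p y is divisible by p^2, so the sum has valuation exactly 1. *)
Lemma sum_expn1pM_mod_sqr p y n :
  exists c, (\sum_(i < n) (1 + p * y) ^ i
             = n + 'C(n, 2) * (p * y) + c * p ^ 2)%N.
Proof.
elim: n => [|n [c IH]]; first by exists 0%N; rewrite big_ord0.
have [d Hd] := expn1pM_mod_sqr p y n.
exists (c + d)%N; rewrite big_ord_recr /= IH Hd binS bin1; ring.
Qed.

Lemma logn_geom_sum_prime p y :
  prime p -> odd p -> logn p (\sum_(i < p) (1 + p * y) ^ i) = 1%N.
Proof.
move=> pr odp; have [c ->] := sum_expn1pM_mod_sqr p y p.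
have p_gt0 := prime_gt0 pr.
have p_dvd_bin : (p %| 'C(p, 2))%N.
  by apply: prime_dvd_bin => //; rewrite odd_prime_gt2.
case/dvdnP: p_dvd_bin => q ->.
have -> : (p + q * p * (p * y) + c * p ^ 2 = p * (1 + p * (q * y + c)))%N by ring.
rewrite lognM // logn_prime // eqxx (_ : logn p (1 + _) = 0)%N //.
apply: logn_coprime; rewrite prime_coprime // dvdn_addl ?dvdn_mulr //.
by rewrite dvdn1 gtn_eqF ?prime_gt1.
Qed.

Lemma logn_geom_sum_coprime p y n :
  prime p -> ~~ (p %| n)%N -> logn p (\sum_(i < n) (1 + p * y) ^ i) = 0%N.
Proof.
move=> pr ndvd; have [c ->] := sum_expn1pM_mod_sqr p y n.
apply: logn_coprime; rewrite prime_coprime //.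
by rewrite -addnA dvdn_addl // dvdn_add // dvdn_mull // dvdn_mulr.
Qed.

(** Both cases come from x^k - 1 = (x - 1)(1 + x + ... + x^(k-1)), where the
    geometric sum has valuation 0 if k is prime to p and 1 if k = p.  The
    exponent n = t p^e is reached by raising x to the power p, e times, and
    then to the power t; x stays congruent to 1 modulo p throughout. *)
Lemma logn_expn_sub1 p x n :
  prime p -> odd p -> (1 < x)%N -> (p %| x - 1)%N -> (0 < n)%N ->
  logn p (x ^ n - 1) = (logn p (x - 1) + logn p n)%N.
Proof.
move=> pr odp + + n_gt0.
have step z k : (1 < z)%N -> (0 < k)%N ->
    logn p (z ^ k - 1)
      = (logn p (z - 1) + logn p (\sum_(i < k) z ^ i))%N.
  move=> z_gt1 k_gt0; rewrite !subn1 predn_exp lognM //; first by lia.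
  by case: k k_gt0 => // k _; rewrite big_ord_recl expn0.
have shape z : (1 < z)%N -> (p %| z - 1)%N -> exists y, z = (1 + p * y)%N.
  by move=> z_gt1 /dvdnP[y zy]; exists y; lia.
have [t cop ->] := pfactor_coprime pr n_gt0.
have t_gt0 : (0 < t)%N.
  rewrite lt0n; apply: contraTneq cop => ->.
  by rewrite /coprime gcdn0 gtn_eqF ?prime_gt1.
rewrite lognM ?expn_gt0 ?(prime_gt0 pr) // pfactorK // (logn_coprime cop) add0n.
elim: (logn p n) x => [|e IH] x x_gt1 dvd_px.
  rewrite muln1 step //; congr addn; have [y ->] := shape x x_gt1 dvd_px.
  by rewrite logn_geom_sum_coprime // -prime_coprime.
have p_gt0 := prime_gt0 pr.
rewrite expnS mulnCA expnM IH.
- rewrite step //; have [y ->] := shape x x_gt1 dvd_px.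
  by rewrite logn_geom_sum_prime // -addnA add1n.
- by rewrite -(expn1 1%N) (leq_trans x_gt1) // -{1}(expn1 x) leq_exp2l.
- by apply: dvdn_trans dvd_px _; rewrite !subn1 predn_exp dvdn_mulr.
Qed.

(** * The valuations of Mersenne numbers *)

Lemma dvdn_expn2_sub1 p n : prime p -> odd p ->
  (p %| 2 ^ n - 1)%N = (ord2 p %| n)%N.
Proof.
move=> pr odp.
have p_gt1 := prime_gt1 pr.
rewrite /ord2 order_dvdn -val_eqE FinRing.val_unitX FinRing.val_unit1.
rewrite val_insubd unitZpE // coprimen2 odp -natrX -val_eqE /=.
rewrite val_Zp_nat // -eqn_mod_dvd ?expn_gt0 //.
by rewrite Zp_cast.
Qed.

Lemma dvdn_expn2_pred_sub1 p : prime p -> odd p -> (p %| 2 ^ p.-1 - 1)%N.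
Proof.
move=> pr odp.
rewrite -eqn_mod_dvd ?expn_gt0 // -totient_prime // Euler_exp_totient //.
by rewrite coprime2n.
Qed.

Lemma ord2_dvd_pred p : prime p -> odd p -> (ord2 p %| p.-1)%N.
Proof.
by move=> pr odp; rewrite -dvdn_expn2_sub1 // dvdn_expn2_pred_sub1.
Qed.

Lemma logn_ord2 p : prime p -> odd p -> logn p (ord2 p) = 0%N.
Proof.
move=> pr odp.
apply: ltn_log0; have p_gt1 := prime_gt1 pr.
by have := dvdn_leq _ (ord2_dvd_pred pr odp); lia.
Qed.

Lemma expA_gt0 p : prime p -> odd p -> (0 < expA p)%N.
Proof.
move=> pr odp.
have ord_gt0 : (0 < ord2 p)%N by rewrite order_gt0.
rewrite /expA logn_gt0 mem_primes pr dvdn_expn2_sub1 // dvdnn andbT /=.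
by rewrite subn_gt0 -{1}(expn0 2) ltn_exp2l.
Qed.

(** The exponent is lifted from 2^d to 2^m, where d is the order of 2; the
    quotient m / d and m have the same valuation because d divides p - 1. *)
Lemma logn_mersenne p m : prime p -> odd p ->
  (0 < m)%N -> (p %| 2 ^ m - 1)%N ->
  logn p (2 ^ m - 1) = (expA p + logn p m)%N.
Proof.
move=> pr odp m_gt0; rewrite dvdn_expn2_sub1 // => /dvdnP[t mt].
have ord_gt0 : (0 < ord2 p)%N by rewrite order_gt0.
have t_gt0 : (0 < t)%N by move: m_gt0; rewrite mt muln_gt0; case/andP.
rewrite mt lognM // logn_ord2 // addn0 mulnC expnM logn_expn_sub1 //.
- by rewrite -{1}(expn0 2) ltn_exp2l.
- by rewrite dvdn_expn2_sub1.
Qed.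

(** As p does not divide p - 1, the valuation of 2^(p-1) - 1 is A_p itself. *)
Lemma wieferichE p : prime p -> odd p -> wieferich p = (1 < expA p)%N.
Proof.
move=> pr odp.
have p1_gt0 : (0 < p.-1)%N by have := prime_gt1 pr; lia.
have N_gt0 : (0 < 2 ^ p.-1 - 1)%N by rewrite subn_gt0 -{1}(expn0 2) ltn_exp2l.
rewrite /wieferich pr odp /= subn1 eqn_mod_dvd ?expn_gt0 //.
rewrite pfactor_dvdn // logn_mersenne ?dvdn_expn2_pred_sub1 //.
by rewrite [logn p p.-1]ltn_log0 ?addn0 // ltn_predL prime_gt0.
Qed.

(** * The Mersenne defect and its Wieferich part *)

Lemma mersenne_gt0 m : (0 < m)%N -> (0 < 2 ^ m - 1)%N.
Proof. by move=> m_gt0; rewrite subn_gt0 -{1}(expn0 2) ltn_exp2l. Qed.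

Lemma odd_mersenne m : (0 < m)%N -> odd (2 ^ m - 1).
Proof.
by move=> m_gt0; rewrite oddB ?expn_gt0 // oddX eqn0Ngt m_gt0.
Qed.

Lemma odd_prime_mersenne m p :
  (0 < m)%N -> p \in primes (2 ^ m - 1)%N -> odd p.
Proof.
move=> m_gt0; rewrite mem_primes => /and3P[_ _ dvd_p].
exact: dvdn_odd dvd_p (odd_mersenne m_gt0).
Qed.

Lemma ln_prod_expn (R : realType) (s : seq nat) (e : nat -> nat) :
  all (ltn 0) s ->
  ln (\prod_(p <- s) p ^ e p)%N%:R = \sum_(p <- s) (e p)%:R * ln p%:R :> R.
Proof.
elim: s => [|p s IH] /=; first by rewrite !big_nil ln1.
case/andP=> p_gt0 s_gt0; rewrite !big_cons natrM lnM ?posrE ?ltr0n //.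
- by rewrite IH // natrX lnXn ?ltr0n // mulr_natl.
- by rewrite expn_gt0 p_gt0.
- rewrite big_seq; apply: prodn_cond_gt0 => q /(allP s_gt0) /= q_gt0.
  by rewrite expn_gt0 q_gt0.
Qed.

Lemma prod_primes_logn n : (0 < n)%N -> n = (\prod_(p <- primes n) p ^ logn p n)%N.
Proof.
by move=> n_gt0; rewrite {1}[n]prod_prime_decomp // prime_decompE big_map.
Qed.

Lemma all_primes_gt0 n : all (ltn 0) (primes n).
Proof.
by apply/allP => p; rewrite mem_primes => /andP[/prime_gt0].
Qed.

(** The identity holds term by term in the sum over the primes p dividing
    2^m - 1: p contributes (A_p - 1 + v_p(m)) log p to Delta_m, and A_p - 1
    vanishes outside the Wieferich primes. *)
Lemma Delta_sub_Omega (R : realType) m : (0 < m)%N ->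
  Delta R m - Omega R m = ln (prodG m)%:R.
Proof.
move=> m_gt0; have N_gt0 := mersenne_gt0 m_gt0.
have pos := all_primes_gt0 (2 ^ m - 1)%N.
have radE : Defs.rad (2 ^ m - 1)%N = (\prod_(p <- primes (2 ^ m - 1)) p ^ 1)%N.
  by apply: eq_bigr => p _; rewrite expn1.
have rad_gt0 : (0 < Defs.rad (2 ^ m - 1))%N.
  by rewrite /Defs.rad big_seq; apply: prodn_cond_gt0 => p /(allP pos).
rewrite /Delta ln_div ?posrE ?ltr0n // radE {1}(prod_primes_logn N_gt0).
rewrite /prodG !ln_prod_expn // /Omega [X in _ - X]big_mkcond /= -!sumrB.
apply: eq_big_seq => p pN.
have odp := odd_prime_mersenne m_gt0 pN.
move: pN; rewrite mem_primes => /and3P[pr _ dvd_p].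
rewrite logn_mersenne // wieferichE // natrD.
case: ltnP => [_|expA_le1]; first by ring.
have -> : expA p = 1%N by have := expA_gt0 pr odp; lia.
by ring.
Qed.

(** With G_m in this form, comparing it with the odd part of m only requires
    comparing sets of primes. *)
Lemma prodG_partn m : (0 < m)%N -> prodG m = (m`_\pi(2 ^ m - 1)%N)%N.
Proof.
move=> m_gt0; set N := (2 ^ m - 1)%N.
have N_gt0 : (0 < N)%N := mersenne_gt0 m_gt0.
have le_mN : (m <= N)%N by rewrite /N -ltnS subn1 prednK ?expn_gt0 // ltn_expl.
rewrite (widen_partn _ le_mN) -big_filter /prodG -/N; apply: perm_big.
rewrite uniq_perm ?primes_uniq ?filter_uniq ?iota_uniq // => p.
rewrite mem_filter mem_index_iota /=.
have [pN|//] := boolP (p \in primes N).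
by move: pN; rewrite mem_primes ltnS => /and3P[_ _ /dvdn_leq->].
Qed.

Lemma partn2C m : (0 < m)%N -> (2 ^ logn 2 m * m`_2^')%N = m.
Proof. by move=> m_gt0; rewrite -p_part partnC. Qed.

Lemma prodG_dvd_odd_part m : (0 < m)%N -> (prodG m %| m`_2^')%N.
Proof.
move=> m_gt0; rewrite prodG_partn //; apply: sub_in_partn => p _ pN.
by rewrite !inE; apply: contraTneq (odd_prime_mersenne m_gt0 pN) => ->.
Qed.

(** * The exponents lcm(1, ..., k) *)

Lemma lcm_uptoS k : lcm_upto k.+1 = lcmn (lcm_upto k) k.+1.
Proof. by rewrite /lcm_upto big_nat_recr. Qed.

Lemma lcm_upto_gt0 k : (0 < lcm_upto k)%N.
Proof.
elim: k => [|k IH]; first by rewrite /lcm_upto big_geq.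
by rewrite lcm_uptoS lcmn_gt0 IH.
Qed.

Lemma dvdn_lcm_upto i k : (0 < i <= k)%N -> (i %| lcm_upto k)%N.
Proof.
elim: k => [|k IH]; first by case: i.
case/andP=> i_gt0; rewrite lcm_uptoS leq_eqVlt ltnS => /predU1P[->|le_ik].
  exact: dvdn_lcmr.
by apply: dvdn_trans (dvdn_lcml _ _); rewrite IH ?i_gt0.
Qed.

Lemma pfactor_lcm_upto_le p k : (0 < k)%N -> (p ^ logn p (lcm_upto k) <= k)%N.
Proof.
elim: k => // -[_ _|k IH _].
  by rewrite lcm_uptoS /lcm_upto big_geq // lcm1n logn1.
rewrite lcm_uptoS logn_lcm ?lcm_upto_gt0 // /maxn; case: ifP => _.
  by rewrite dvdn_leq // pfactor_dvdnn.
by rewrite (leq_trans (IH _)).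
Qed.

Lemma prime_dvd_lcm_upto_le p k : prime p -> (p %| lcm_upto k)%N -> (p <= k)%N.
Proof.
move=> pr; elim: k => [|k IH].
  by rewrite /lcm_upto big_geq // dvdn1 gtn_eqF ?prime_gt1.
move=> dvd_p; have : (p %| lcm_upto k * k.+1)%N.
  by apply: dvdn_trans dvd_p _; rewrite lcm_uptoS -muln_lcm_gcd dvdn_mulr.
by rewrite Euclid_dvdM // => /orP[/IH/leqW|/dvdn_leq] //; apply.
Qed.

(** An odd prime p dividing lcm(1, ..., k) is at most k, so the order of 2
    modulo p divides p - 1, which is one of 1, ..., k. *)
Lemma prodG_lcm_upto k : prodG (lcm_upto k) = ((lcm_upto k)`_2^')%N.
Proof.
have m_gt0 := lcm_upto_gt0 k.
rewrite prodG_partn //; apply: eq_in_partn => p.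
rewrite /= mem_primes => /and3P[pr _ dvd_pm].
have le_pk := prime_dvd_lcm_upto_le pr dvd_pm.
rewrite !inE mem_primes pr mersenne_gt0 //=.
have [->|odp] := even_prime pr.
  by rewrite eqxx dvdn2 odd_mersenne.
rewrite dvdn_expn2_sub1 // (dvdn_trans (ord2_dvd_pred pr odp)).
  by apply/esym; apply: contraTneq odp => ->.
by apply: dvdn_lcm_upto; have := prime_gt1 pr; lia.
Qed.

(** The numbers 1 / ((n + 1) C(n, j)) form Leibniz's harmonic triangle, in
    which each entry is obtained by subtraction:
      1 / ((n+2) C(n+1, j+1)) = 1 / ((n+1) C(n, j)) - 1 / ((n+2) C(n+1, j)).
    Starting from the entries 1 / i, the left edge of the triangle, all
    entries therefore become integers when multiplied by D. *)
Lemma leibniz_harmonic_dvd D n j :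
  (forall i, (0 < i <= n.+1)%N -> (i %| D)%N) -> (j <= n)%N ->
  (n.+1 * 'C(n, j) %| D)%N.
Proof.
elim: j n => [|j IH] n dvdD le_jn; first by rewrite bin0 muln1 dvdD //=.
case: n dvdD le_jn => // n dvdD le_jn.
have /dvdnP[a aE] : (n.+1 * 'C(n, j) %| D)%N.
  by apply: IH => // i /andP[i_gt0 /leqW le_in]; rewrite dvdD ?i_gt0.
have /dvdnP[b bE] : (n.+2 * 'C(n.+1, j) %| D)%N by apply: IH => //; apply: ltnW.
apply/dvdnP; exists (a - b)%N.
(* Multiplied by j + 1, the two terms of the difference are the multiples
   n + 2 and n + 1 - j of D. *)
apply/eqP; rewrite -(eqn_pmul2l (ltn0Sn j)) mulnBl mulnBr.
have upE : (j.+1 * (a * (n.+2 * 'C(n.+1, j.+1))) = n.+2 * D)%N.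
  transitivity (n.+2 * (a * (j.+1 * 'C(n.+1, j.+1))))%N; first by ring.
  by rewrite -mul_bin_diag aE.
have downE : (j.+1 * (b * (n.+2 * 'C(n.+1, j.+1))) = (n.+1 - j) * D)%N.
  transitivity (b * n.+2 * (j.+1 * 'C(n.+1, j.+1)))%N; first by ring.
  by rewrite mul_bin_left bE mulnCA -!mulnA.
rewrite upE downE -mulnBl; apply/eqP; congr muln; lia.
Qed.

(** With k = n + 1, summing (n + 1) C(n, j) <= lcm(1, ..., k) over the n + 1
    values of j gives (n + 1) 2^n <= (n + 1) lcm(1, ..., k). *)
Lemma expn2_le_double_lcm_upto k : (0 < k)%N -> (2 ^ k <= 2 * lcm_upto k)%N.
Proof.
case: k => // n _; rewrite expnS leq_pmul2l //.
have -> : (2 ^ n = \sum_(i < n.+1) 'C(n, i))%N.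
  by rewrite -[2%N]/(1 + 1)%N expnDn; apply: eq_bigr => i _; rewrite !exp1n !muln1.
have leib_le (i : 'I_n.+1) : (n.+1 * 'C(n, i) <= lcm_upto n.+1)%N.
  rewrite dvdn_leq ?lcm_upto_gt0 //.
  apply: leibniz_harmonic_dvd => [d|]; first exact: dvdn_lcm_upto.
  by rewrite -ltnS.
rewrite -(leq_pmul2l (ltn0Sn n)) big_distrr /=.
rewrite -[X in (_ <= X * _)%N](card_ord n.+1) -sum_nat_const.
by apply: leq_sum => i _.
Qed.

Lemma ler_ln_nat (R : realType) a b : (0 < a)%N -> (a <= b)%N ->
  ln a%:R <= ln b%:R :> R.
Proof.
move=> a_gt0 le_ab; rewrite ler_ln ?posrE ?ltr0n ?ler_nat //.
exact: leq_trans le_ab.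
Qed.

Lemma nat_le_log2_double_lcm_upto (R : realType) k : (0 < k)%N ->
  k%:R <= log2 (2 * (lcm_upto k)%:R) :> R.
Proof.
move=> k_gt0; have ln2_gt0 : 0 < ln 2 :> R by rewrite ln_gt0 // ltr1n.
rewrite /log2 ler_pdivlMr // [k%:R * _]mulr_natl -lnXn // -natrM -natrX.
by rewrite ler_ln_nat ?expn_gt0 ?expn2_le_double_lcm_upto.
Qed.

(** * Bounds for the non-Wieferich part of the defect *)

Theorem theorem6p33 (R : realType) :
  (forall m : nat, (2 <= m)%N ->
     [/\ Delta R m - Omega R m = ln (prodG m)%:R,
         ln (prodG m)%:R <= ln (m%:R / (2 ^ logn 2 m)%N%:R) :> R
       & ln (m%:R / (2 ^ logn 2 m)%N%:R) <= ln m%:R :> R])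
  /\
  (forall k : nat, (1 <= k)%N ->
     ln (lcm_upto k)%:R - ln (log2 (2 * (lcm_upto k)%:R))
       <= Delta R (lcm_upto k) - Omega R (lcm_upto k))
  /\
  (forall u : nat -> nat, (forall j, (2 <= u j)%N) ->
     Delta R (u j) - ln (u j)%:R @[j --> \oo] --> +oo ->
     Omega R (u j) @[j --> \oo] --> +oo).
Proof.
have prodG_gt0 m : (0 < m)%N -> (0 < prodG m)%N.
  by move=> m_gt0; rewrite prodG_partn.
have bounds m : (2 <= m)%N ->
    [/\ Delta R m - Omega R m = ln (prodG m)%:R,
        ln (prodG m)%:R <= ln (m%:R / (2 ^ logn 2 m)%N%:R) :> R
      & ln (m%:R / (2 ^ logn 2 m)%N%:R) <= ln m%:R :> R].
  move=> m_ge2; have m_gt0 : (0 < m)%N by apply: ltnW.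
  have -> : m%:R / (2 ^ logn 2 m)%N%:R = (m`_2^')%N%:R :> R.
    by rewrite -{1}(partn2C m_gt0) natrM mulrAC mulfV ?mul1r // pnatr_eq0.
  split; first exact: Delta_sub_Omega.
    by rewrite ler_ln_nat ?prodG_gt0 // dvdn_leq // prodG_dvd_odd_part.
  by rewrite ler_ln_nat // dvdn_leq // dvdn_part.
split=> [//|]; split=> [k k_gt0|u u_ge2 Delta_cvg].
  rewrite Delta_sub_Omega ?lcm_upto_gt0 // prodG_lcm_upto lerBlDr.
  rewrite -{1}(partn2C (lcm_upto_gt0 k)) natrM lnM ?posrE ?ltr0n ?expn_gt0 //.
  have le_klog := nat_le_log2_double_lcm_upto R k_gt0.
  rewrite addrC lerD2l ler_ln ?posrE ?ltr0n ?expn_gt0 //.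
    by rewrite (le_trans _ le_klog) // ler_nat pfactor_lcm_upto_le.
  by rewrite (lt_le_trans _ le_klog) // ltr0n.
apply: ger_cvgy Delta_cvg; apply: nearW => j.
have [dE le1 le2] := bounds _ (u_ge2 j); move: dE le1 le2; lra.
Qed.
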